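(* Let $R$ be an associative ring with identity and let $e\in R$ be an idempotent ($e^2=e$). Equip $R$ with the topology $\tau_e=\{I\subseteq R \mid Ie\subseteq I\}$. Then $Re=\{re \mid r\in R\}$ is a left ideal of $R$ that is open and dense in $(R,\tau_e)$.
   Context: Rings are associative with identity, not necessarily commutative. For $a\in R$ and $I\subseteq R$, $Ia=\{xa\mid x\in I\}$, and $\tau_a=\{I\subseteq R\mid Ia\subseteq I\}$ is a topology on the set $R$ (its members are the open sets), called the element absorb topology related to $a$. When $a=e$ is idempotent it is called the projection invariant topology. *)

(* Defs.v *)
From HB Require Import structures.
From mathcomp Require Import all_boot all_algebra.
From mathcomp Require Import all_classical topology.

Set Implicit Arguments.
Unset Strict Implicit.
Unset Printing Implicit Defensive.

Import GRing.Theory.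

Local Open Scope classical_set_scope.
Local Open Scope ring_scope.

(* [pzRingType] rather than [nzRingType]: the zero ring is allowed. *)

Definition rmulset (R : pzRingType) (I : set R) (a : R) : set R :=
  [set x * a | x in I].

(* [idealr_closed] of ring_quotient is not used: it also demands [1 \notin S]
   and is only available over nonzero rings. *)
Definition left_ideal (R : pzRingType) (I : set R) : Prop :=
  zmod_closed (mem I) /\ forall r x : R, x \in I -> r * x \in I.

Definition absorb_open (R : pzRingType) (a : R) : set_system R :=
  [set I : set R | rmulset I a `<=` I].

(* Alias of [R] carrying the element absorb topology related to [a]. *)
Definition absorb_space (R : pzRingType) (a : R) : Type := R.

HB.instance Definition _ (R : pzRingType) (a : R) :=
  Choice.copy (absorb_space a) R.

Section AbsorbTopology.
Variables (R : pzRingType) (a : R).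

Lemma absorb_openT : absorb_open a setT.
Proof. by []. Qed.

Lemma absorb_openI : setI_closed (absorb_open a).
Proof.
move=> I J oI oJ _ [x [Ix Jx] <-].
by split; [apply: oI; exists x | apply: oJ; exists x].
Qed.

Lemma absorb_open_bigU (K : Type) (f : K -> set R) :
  (forall i, absorb_open a (f i)) -> absorb_open a (\bigcup_i f i).
Proof.
by move=> of_ _ [x [i _ fix_] <-]; exists i => //; apply: of_; exists x.
Qed.

HB.instance Definition _ := isOpenTopological.Build (absorb_space a)
  absorb_openT absorb_openI absorb_open_bigU.

Lemma absorb_openE :
  (open : set_system (absorb_space a)) = [set I | rmulset I a `<=` I].
Proof. by []. Qed.

End AbsorbTopology.

(* Main.v *)
(** Multiplying on the right by [e] fixes [Re] pointwise, so [Re] is open; and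
    an open set containing [x] also contains [x * e], which lies in [Re]. *)

Require Import Defs.
From mathcomp Require Import all_boot all_algebra.
From mathcomp Require Import all_classical topology.

Import GRing.Theory.

Local Open Scope classical_set_scope.
Local Open Scope ring_scope.

(** Right multiplication by [e] is an idempotent left [R]-linear map with image [Re], and the open
    sets are those it maps into themselves. An image under a linear map is a left ideal, and this
    one meets every nonempty stable set. *)

Lemma left_ideal_principal (R : pzRingType) (a : R) :
  left_ideal [set r * a | r in [set: R]].
Proof.
split; first split.
- by apply/mem_set; exists 0; rewrite ?mul0r.
- move=> _ _ /set_mem[r _ <-] /set_mem[s _ <-].
  by apply/mem_set; exists (r - s); rewrite ?mulrBl.
- move=> r _ /set_mem[s _ <-].
  by apply/mem_set; exists (r * s); rewrite ?mulrA.
Qed.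

Theorem theorem3p1 (R : pzRingType) (e : R) (idem_e : e * e = e) :
  let Re : set R := [set r * e | r in [set: R]] in
  [/\ left_ideal Re,
      open (Re : set (absorb_space e))
    & dense (Re : set (absorb_space e))].
Proof.
split.
- exact: left_ideal_principal.
- rewrite absorb_openE => _ [_ [r _ <-] <-].
  (* The same [r] serves again, since [r * e * e = r * e]. *)
  by exists r => //; rewrite -mulrA idem_e.
- move=> O [x Ox]; rewrite absorb_openE => oO.
  (* [x * e] stays in [O] by stability, and lies in [Re] by its form. *)
  by exists (x * e); split; [apply: oO; exists x | exists x].
Qed.
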